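(* Let $g,f_1,f_2:\mathbb{R}^2\times\mathbb{R}\to\mathbb{R}$ be smooth functions of $(x,y,\alpha)$ and consider the two-dimensional quasilinear differential-algebraic system $$g(x,y,\alpha)\,\dot x=f_1(x,y,\alpha),\qquad \dot y=f_2(x,y,\alpha).$$ Assume that $M=(0,0)$ is a cubic fold point at $\alpha=0$, i.e. $g=g_x=g_{xx}=0$ at $(0,0,0)$, and that at $(x,y,\alpha)=(0,0,0)$ $$f_1\neq0,\quad g_y\neq0,\quad g_{xxx}\neq0,\quad \det\frac{\partial(g,g_x)}{\partial(y,\alpha)}\neq0 .$$ Then for small $\alpha\neq0$ the point $M$ either splits into a pair of simple folds or disappears: there are a neighbourhood $U$ of $M$ and $\alpha_0>0$ such that for every $\alpha$ with $0<|\alpha|<\alpha_0$, either the system has exactly two fold points in $U$ and both are simple, or it has no fold points in $U$.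
   Context: Subscripts denote partial derivatives. For fixed $\alpha$, a fold point (or fold) is a point $(x,y)$ with $g(x,y,\alpha)=g_x(x,y,\alpha)=0$. A fold is simple if at this point $f_1\neq0$, $g_y\neq0$ and $g_{xx}\neq0$. *)

(* Defs.v *)
From Stdlib Require Import Reals.
From Coquelicot Require Import Coquelicot.

Open Scope R_scope.

(* Functions of (x, y, alpha) are curried, in this order of arguments. *)
Definition partial_x (f : R -> R -> R -> R) : R -> R -> R -> R :=
  fun x y a => Derive (fun t => f t y a) x.
Definition partial_y (f : R -> R -> R -> R) : R -> R -> R -> R :=
  fun x y a => Derive (fun t => f x t a) y.
Definition partial_a (f : R -> R -> R -> R) : R -> R -> R -> R :=
  fun x y a => Derive (fun t => f x y t) a.

(* [Derive] is total; this says that it returns genuine partial derivatives. *)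
Definition has_partials (f : R -> R -> R -> R) : Prop :=
  forall x y a,
    ex_derive (fun t => f t y a) x /\
    ex_derive (fun t => f x t a) y /\
    ex_derive (fun t => f x y t) a.

Fixpoint of_class_C (k : nat) (f : R -> R -> R -> R) : Prop :=
  match k with
  | O => forall p : R * R * R,
      continuous (fun q : R * R * R => f (fst (fst q)) (snd (fst q)) (snd q)) p
  | S k' => has_partials f /\
      of_class_C k' (partial_x f) /\ of_class_C k' (partial_y f) /\ of_class_C k' (partial_a f)
  end.

Definition smooth (f : R -> R -> R -> R) : Prop := forall k, of_class_C k f.

(* Determinant of the matrix d(u,v)/d(y,alpha) = ((u_y, u_alpha), (v_y, v_alpha)). *)
Definition jacobian_ya (u v : R -> R -> R -> R) (x y a : R) : R :=
  partial_y u x y a * partial_a v x y a - partial_a u x y a * partial_y v x y a.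

(* The system  g(x,y,alpha) x' = f1(x,y,alpha),  y' = f2(x,y,alpha). *)
Record quasilinear_DAE := QuasilinearDAE {
  dae_g : R -> R -> R -> R;
  dae_f1 : R -> R -> R -> R;
  dae_f2 : R -> R -> R -> R
}.

Definition smooth_DAE (S : quasilinear_DAE) : Prop :=
  smooth (dae_g S) /\ smooth (dae_f1 S) /\ smooth (dae_f2 S).

Definition fold_point (S : quasilinear_DAE) (a : R) (p : R * R) : Prop :=
  let (x, y) := p in
  dae_g S x y a = 0 /\ partial_x (dae_g S) x y a = 0.

Definition simple_fold (S : quasilinear_DAE) (a : R) (p : R * R) : Prop :=
  fold_point S a p /\
  let (x, y) := p in
  dae_f1 S x y a <> 0 /\
  partial_y (dae_g S) x y a <> 0 /\
  partial_x (partial_x (dae_g S)) x y a <> 0.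

Definition cubic_fold_point (S : quasilinear_DAE) (a : R) (p : R * R) : Prop :=
  fold_point S a p /\
  let (x, y) := p in partial_x (partial_x (dae_g S)) x y a = 0.

Definition exactly_two_folds_both_simple
    (S : quasilinear_DAE) (a : R) (U : R * R -> Prop) : Prop :=
  exists p q : R * R,
    p <> q /\
    (forall r, (U r /\ fold_point S a r) <-> (r = p \/ r = q)) /\
    simple_fold S a p /\ simple_fold S a q.

Definition no_folds (S : quasilinear_DAE) (a : R) (U : R * R -> Prop) : Prop :=
  forall r, U r -> ~ fold_point S a r.

(* Main.v *)
Require Import Defs.
From Stdlib Require Import Reals Lra Ranalysis5 IndefiniteDescription.
From Coquelicot Require Import Coquelicot.

Open Scope R_scope.

(** Since [g_y <> 0], the equation [g = 0] is solved locally by [y = Y(x, alpha)], and the folds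
    become the zeros of [h(x, alpha) = g_x(x, Y(x, alpha), alpha)].  At the origin [h = h_x = 0],
    [h_xx = g_xxx <> 0] and [h_alpha = det / g_y <> 0].  After multiplication by [g_xxx(0,0,0)],
    [h] is strictly convex in [x], with minimum value [0] at [alpha = 0], and strictly monotone in
    [alpha]; hence for one sign of [alpha] it has no zero, and for the other exactly two, at which
    [h_x <> 0].  At a fold [Y_x = - g_x / g_y = 0], so there [h_x = g_xx], and the folds are simple. *)

(** * One-variable calculus: monotonicity and Rolle from the mean value theorem *)

Lemma is_derive_continuity_pt (f : R -> R) (x l : R) :
  is_derive f x l -> continuity_pt f x.
Proof.
  intros H. apply continuity_pt_filterlim.
  apply (ex_derive_continuous (V := R_NormedModule)). now exists l.
Qed.

Lemma is_derive_MVT (f df : R -> R) (a b : R) :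
  a < b -> (forall x, a <= x <= b -> is_derive f x (df x)) ->
  exists c, a < c < b /\ f b - f a = df c * (b - a).
Proof.
  intros Hab H.
  destruct (MVT_cor2 f df a b Hab) as [c [Hc1 Hc2]].
  - intros c Hc. now apply is_derive_Reals, H.
  - now exists c.
Qed.

Lemma is_derive_pos_incr (f df : R -> R) (a b : R) :
  a < b -> (forall x, a <= x <= b -> is_derive f x (df x)) ->
  (forall x, a < x < b -> 0 < df x) -> f a < f b.
Proof.
  intros Hab H Hpos.
  destruct (is_derive_MVT f df a b Hab H) as [c [Hc E]].
  assert (0 < df c * (b - a)) by (apply Rmult_lt_0_compat; [now apply Hpos | lra]).
  lra.
Qed.

Lemma is_derive_neg_decr (f df : R -> R) (a b : R) :
  a < b -> (forall x, a <= x <= b -> is_derive f x (df x)) ->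
  (forall x, a < x < b -> df x < 0) -> f b < f a.
Proof.
  intros Hab H Hneg.
  destruct (is_derive_MVT f df a b Hab H) as [c [Hc E]].
  assert (0 < - df c * (b - a)).
  { apply Rmult_lt_0_compat; [specialize (Hneg c Hc) |]; lra. }
  lra.
Qed.

Lemma is_derive_Rolle (f df : R -> R) (a b : R) :
  a < b -> (forall x, a <= x <= b -> is_derive f x (df x)) -> f a = f b ->
  exists c, a < c < b /\ df c = 0.
Proof.
  intros Hab H E.
  destruct (is_derive_MVT f df a b Hab H) as [c [Hc E']].
  exists c. split; [easy |].
  destruct (Rmult_integral (df c) (b - a)); lra.
Qed.

(** * Continuity and joint differentiability of smooth functions of three variables *)

Definition uncurry3 (f : R -> R -> R -> R) (q : R * R * R) : R :=
  f (fst (fst q)) (snd (fst q)) (snd q).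

Lemma smooth_continuous (f : R -> R -> R -> R) (p : R * R * R) :
  smooth f -> continuous (uncurry3 f) p.
Proof. intros H. exact (H 0%nat p). Qed.

Lemma smooth_is_derive_x (f : R -> R -> R -> R) (x y a : R) :
  smooth f -> is_derive (fun t => f t y a) x (partial_x f x y a).
Proof. intros Hf. destruct (Hf 1%nat) as [H _]. apply Derive_correct, (H x y a). Qed.

Lemma smooth_is_derive_y (f : R -> R -> R -> R) (x y a : R) :
  smooth f -> is_derive (fun t => f x t a) y (partial_y f x y a).
Proof. intros Hf. destruct (Hf 1%nat) as [H _]. apply Derive_correct, (H x y a). Qed.

Lemma smooth_is_derive_a (f : R -> R -> R -> R) (x y a : R) :
  smooth f -> is_derive (fun t => f x y t) a (partial_a f x y a).
Proof. intros Hf. destruct (Hf 1%nat) as [H _]. apply Derive_correct, (H x y a). Qed.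

Lemma smooth_partial_x (f : R -> R -> R -> R) : smooth f -> smooth (partial_x f).
Proof. intros H k. apply (H (S k)). Qed.

Lemma smooth_partial_y (f : R -> R -> R -> R) : smooth f -> smooth (partial_y f).
Proof. intros H k. apply (H (S k)). Qed.

Lemma smooth_partial_a (f : R -> R -> R -> R) : smooth f -> smooth (partial_a f).
Proof. intros H k. apply (H (S k)). Qed.

Lemma continuous_uncurry3_comp {T : UniformSpace} (f : R -> R -> R -> R)
  (u v w : T -> R) (t : T) :
  smooth f -> continuous u t -> continuous v t -> continuous w t ->
  continuous (fun s => f (u s) (v s) (w s)) t.
Proof.
  intros Hf Hu Hv Hw.
  apply (continuous_comp_2 (fun s => (u s, v s)) w
           (fun q z => f (fst q) (snd q) z)).
  - apply (continuous_comp_2 u v (fun x y => (x, y))); try easy.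
    apply continuous_ext with (fun q : R * R => q); [now intros [] | apply continuous_id].
  - easy.
  - apply (smooth_continuous f (u t, v t, w t) Hf).
Qed.

(** Joint differentiability follows because the partial derivative in [x] exists everywhere and is
    jointly continuous; of the one in [y], existence at the point is enough. *)
Lemma smooth_differentiable_xy (f : R -> R -> R -> R) (x y a : R) :
  smooth f ->
  differentiable_pt_lim (fun u v => f u v a) x y (partial_x f x y a) (partial_y f x y a).
Proof.
  intros Hf. apply filterdiff_differentiable_pt_lim.
  apply (is_derive_filterdiff (fun u v => f u v a) x y (fun u v => partial_x f u v a)).
  - apply filter_forall. intros [u v]. now apply smooth_is_derive_x.
  - now apply smooth_is_derive_y.
  - apply (continuous_uncurry3_comp (T := prod_UniformSpace R_UniformSpace R_UniformSpace)
      (partial_x f) fst snd (fun _ => a)); [now apply smooth_partial_x | | |].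
    + apply continuous_fst.
    + apply continuous_snd.
    + apply continuous_const.
Qed.

(** The variables are taken in the order [(alpha, y)]: the independent variable first and [y]
    second, the shape [phi t (Y t)] in which the chain rule and implicit differentiation are
    stated. *)
Lemma smooth_differentiable_ay (f : R -> R -> R -> R) (x y a : R) :
  smooth f ->
  differentiable_pt_lim (fun u v => f x v u) a y (partial_a f x y a) (partial_y f x y a).
Proof.
  intros Hf. apply filterdiff_differentiable_pt_lim.
  apply (is_derive_filterdiff (fun u v => f x v u) a y (fun u v => partial_a f x v u)).
  - apply filter_forall. intros [u v]. now apply smooth_is_derive_a.
  - now apply smooth_is_derive_y.
  - apply (continuous_uncurry3_comp (T := prod_UniformSpace R_UniformSpace R_UniformSpace)
      (partial_a f) (fun _ => x) snd fst); [now apply smooth_partial_a | | |].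
    + apply continuous_const.
    + apply continuous_snd.
    + apply continuous_fst.
Qed.

(** * Chain rule, implicit differentiation and the implicit function theorem *)

Lemma is_derive_comp_2d (phi : R -> R -> R) (Y : R -> R) (t lt ly l : R) :
  differentiable_pt_lim phi t (Y t) lt ly -> is_derive Y t l ->
  is_derive (fun s => phi s (Y s)) t (lt + ly * l).
Proof.
  intros Hphi HY. apply is_derive_Reals.
  replace (lt + ly * l) with (lt * 1 + ly * l) by ring.
  apply (derivable_pt_lim_comp_2d phi (fun s => s) Y); [easy | |].
  - apply derivable_pt_lim_id.
  - now apply is_derive_Reals.
Qed.

(** Mere continuity of [Y] suffices. With [D] and [E] the increments of [t] and [Y], the vanishing
    of [phi] along the graph gives [lt * D + ly * E = o(max(|D|, |E|))]. Since [ly <> 0], this first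
    forces [E = O(D)], and then the error is [o(D)]. *)
Lemma is_derive_implicit (phi : R -> R -> R) (Y : R -> R) (t lt ly : R) :
  differentiable_pt_lim phi t (Y t) lt ly -> ly <> 0 -> continuous Y t ->
  locally t (fun s => phi s (Y s) = 0) ->
  is_derive Y t (- lt / ly).
Proof.
  intros Hd Hly Hc Hz.
  assert (Hz0 : phi t (Y t) = 0) by apply (locally_singleton _ _ Hz).
  assert (Hlyp : 0 < Rabs ly) by now apply Rabs_pos_lt.
  (* [C] will bound [max(|D|, |E|) / |D|]: absorbing half of [|ly| |E|] leaves
     [|E| <= 2 |lt| / |ly| * |D|], and the summand 1 covers [|D|] itself. *)
  set (C := 2 * Rabs lt / Rabs ly + 1).
  assert (HC : 1 <= C).
  { unfold C. assert (0 <= 2 * Rabs lt / Rabs ly); [| lra].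
    apply Rle_mult_inv_pos; [pose proof (Rabs_pos lt); lra | easy]. }
  split; [apply is_linear_scal_l |].
  intros t' Ht'. apply (is_filter_lim_locally_unique t t') in Ht'. subst t'.
  intros eps.
  (* The first bound permits the absorption; the second becomes [eps * |D|] after multiplication by
     [C * |D|] and division by [|ly|]. *)
  assert (He : 0 < Rmin (Rabs ly / 2) (eps * Rabs ly / C)).
  { apply Rmin_glb_lt; [lra |]. apply Rdiv_lt_0_compat; [| lra].
    apply Rmult_lt_0_compat; [apply cond_pos | easy]. }
  destruct (Hd (mkposreal _ He)) as [dl Hdl]. simpl in Hdl.
  pose proof (Hc _ (locally_ball (Y t) dl)) as Hc'.
  assert (Ht : locally t (fun s => Rabs (s - t) < dl)) by apply (locally_ball t dl).
  unfold filtermap in Hc'.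
  generalize (filter_and _ _ Hz (filter_and _ _ Hc' Ht)).
  apply filter_imp. intros s [Es [Hs1 Hs2]].
  specialize (Hdl s (Y s) Hs2 Hs1). rewrite Es, Hz0 in Hdl.
  unfold norm, minus, plus, opp, scal; simpl. unfold abs, mult; simpl.
  replace (Y s + - Y t + - ((s + - t) * (- lt / ly)))
    with ((lt * (s - t) + ly * (Y s - Y t)) / ly) by (field; easy).
  replace (s + - t) with (s - t) by ring.
  set (D := s - t) in *. set (E := Y s - Y t) in *.
  replace (0 - 0 - (lt * D + ly * E)) with (- (lt * D + ly * E)) in Hdl by ring.
  rewrite Rabs_Ropp in Hdl.
  rewrite Rabs_div by easy.
  set (N := Rabs (lt * D + ly * E)) in *.
  pose proof (Rmin_l (Rabs ly / 2) (eps * Rabs ly / C)) as M1.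
  pose proof (Rmin_r (Rabs ly / 2) (eps * Rabs ly / C)) as M2.
  set (m := Rmin (Rabs ly / 2) (eps * Rabs ly / C)) in *.
  assert (HM0 : 0 <= Rmax (Rabs D) (Rabs E)).
  { apply Rle_trans with (Rabs D); [apply Rabs_pos | apply Rmax_l]. }
  (* As [m <= |ly| / 2], the error term in [E] is absorbed, whence [E = O(D)]. *)
  assert (HM : Rmax (Rabs D) (Rabs E) <= C * Rabs D).
  { apply Rmax_lub; [pose proof (Rabs_pos D); nra |].
    destruct (Rle_lt_dec (Rabs E) (Rabs D)) as [H | H]; [pose proof (Rabs_pos D); nra |].
    rewrite Rmax_right in Hdl by lra.
    assert (HT : Rabs ly * Rabs E <= N + Rabs lt * Rabs D).
    { rewrite <- !Rabs_mult. unfold N.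
      replace (ly * E) with ((lt * D + ly * E) + - (lt * D)) at 1 by ring.
      eapply Rle_trans; [apply Rabs_triang |]. rewrite Rabs_Ropp. lra. }
    assert (m * Rabs E <= Rabs ly / 2 * Rabs E)
      by (apply Rmult_le_compat_r; [apply Rabs_pos | easy]).
    apply Rmult_le_reg_l with (Rabs ly); [easy |].
    replace (Rabs ly * (C * Rabs D)) with (2 * Rabs lt * Rabs D + Rabs ly * Rabs D)
      by (unfold C; field; lra).
    assert (0 <= Rabs ly * Rabs D) by (apply Rmult_le_pos; [lra | apply Rabs_pos]).
    lra. }
  apply Rmult_le_reg_r with (Rabs ly); [easy |].
  unfold Rdiv at 1. rewrite Rmult_assoc, Rinv_l, Rmult_1_r by lra.
  apply Rle_trans with (1 := Hdl).
  apply Rle_trans with (eps * Rabs ly / C * (C * Rabs D)).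
  - apply Rmult_le_compat; lra.
  - right. field. lra.
Qed.

(** The constant [c] carries the sign of [g_y], so [c * g] increases strictly through its zero [y0]
    and has opposite signs at [y0 - d] and [y0 + d]. Both signs survive a small change of [(x, a)],
    and the intermediate value theorem gives a zero between them. This serves both for the existence
    of the implicit function and for its continuity. *)
Lemma zero_persists (g : R -> R -> R -> R) (c x0 y0 a0 d : R) :
  smooth g -> 0 < d -> g x0 y0 a0 = 0 ->
  (forall y, Rabs (y - y0) <= d -> 0 < c * partial_y g x0 y a0) ->
  locally ((x0, a0) : R * R)
    (fun q => exists y, Rabs (y - y0) < d /\ g (fst q) y (snd q) = 0).
Proof.
  intros Hg Hd Hz Hy.
  assert (Hder : forall x a y, is_derive (fun t => c * g x t a) y (c * partial_y g x y a)).
  { intros x a y. apply is_derive_scal. now apply smooth_is_derive_y. }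
  assert (Hcont : forall y, continuous (fun q : R * R => c * g (fst q) y (snd q)) (x0, a0)).
  { intros y. apply (continuous_scal_r c (fun q : R * R => g (fst q) y (snd q))).
    apply (continuous_uncurry3_comp (T := prod_UniformSpace R_UniformSpace R_UniformSpace)
      g fst (fun _ => y) snd); [easy | | |].
    + apply continuous_fst.
    + apply continuous_const.
    + apply continuous_snd. }
  assert (H1 : c * g x0 y0 a0 < c * g x0 (y0 + d) a0).
  { apply (is_derive_pos_incr (fun t => c * g x0 t a0) (fun t => c * partial_y g x0 t a0));
      [lra | intros; apply Hder |].
    intros y Hyy. apply Hy, Rabs_le. lra. }
  assert (H2 : c * g x0 (y0 - d) a0 < c * g x0 y0 a0).
  { apply (is_derive_pos_incr (fun t => c * g x0 t a0) (fun t => c * partial_y g x0 t a0));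
      [lra | intros; apply Hder |].
    intros y Hyy. apply Hy, Rabs_le. lra. }
  rewrite Hz, Rmult_0_r in H1, H2.
  assert (Hc : c <> 0).
  { intros ->. rewrite Rmult_0_l in H1. lra. }
  pose proof (Hcont (y0 + d) _ (open_gt 0 _ H1)) as L1.
  pose proof (Hcont (y0 - d) _ (open_lt 0 _ H2)) as L2.
  unfold filtermap in L1, L2. generalize (filter_and _ _ L1 L2). clear L1 L2.
  apply filter_imp. intros [x a] [L1 L2]; simpl in *.
  destruct (IVT_interv (fun t => c * g x t a) (y0 - d) (y0 + d)) as [y [Hyd Ey]];
    [| lra | easy | easy |].
  { intros t _. apply is_derive_continuity_pt with (c * partial_y g x t a), Hder. }
  exists y. split.
  - apply Rabs_def1.
    + destruct Hyd as [_ [? | ->]]; lra.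
    + destruct Hyd as [[? | <-] _]; lra.
  - apply Rmult_integral in Ey. tauto.
Qed.

Lemma locally_Rabs_lt (t r : R) : Rabs t < r -> locally t (fun s => Rabs s < r).
Proof. intros Ht. exact (continuous_Rabs t _ (open_lt r _ Ht)). Qed.

Lemma locally_box2 (x0 a0 r : R) :
  Rabs x0 < r -> Rabs a0 < r ->
  locally ((x0, a0) : R * R) (fun q => Rabs (fst q) < r /\ Rabs (snd q) < r).
Proof.
  intros Hx Ha. apply filter_and.
  - exact (continuous_fst x0 a0 _ (locally_Rabs_lt _ _ Hx)).
  - exact (continuous_snd x0 a0 _ (locally_Rabs_lt _ _ Ha)).
Qed.

(** Existence comes from [zero_persists] at the origin, uniqueness from Rolle in [y], continuity
    from [zero_persists] at each point of the graph, and the derivatives from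
    [is_derive_implicit]. *)
Lemma implicit_function (g : R -> R -> R -> R) (c r : R) :
  smooth g -> 0 < r -> g 0 0 0 = 0 ->
  (forall x y a, Rabs x < r -> Rabs y < r -> Rabs a < r -> 0 < c * partial_y g x y a) ->
  exists (Y : R -> R -> R) (rho d : R), 0 < rho <= r /\ 0 < d < r /\
    forall x a, Rabs x < rho -> Rabs a < rho ->
      Rabs (Y x a) < d /\
      (forall y, Rabs y < d -> (g x y a = 0 <-> y = Y x a)) /\
      is_derive (fun t => Y t a) x (- partial_x g x (Y x a) a / partial_y g x (Y x a) a) /\
      is_derive (fun t => Y x t) a (- partial_a g x (Y x a) a / partial_y g x (Y x a) a).
Proof.
  intros Hg Hr Hz Hpos.
  (* Strictly below [r], so that the sign of [g_y] is known on the closed interval [|y| <= d]. *)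
  set (d := r / 2).
  assert (R0 : Rabs 0 < r) by now rewrite Rabs_R0.
  assert (Huniq : forall x a y1 y2, Rabs x < r -> Rabs a < r -> Rabs y1 < r -> Rabs y2 < r ->
            y1 < y2 -> g x y1 a = 0 -> g x y2 a = 0 -> False).
  { intros x a y1 y2 Hx Ha Hy1 Hy2 H12 E1 E2.
    apply Rabs_def2 in Hy1. apply Rabs_def2 in Hy2.
    destruct (is_derive_Rolle (fun t => g x t a) (fun t => partial_y g x t a) y1 y2 H12)
      as [y [Hy Ey]].
    - intros y _. now apply smooth_is_derive_y.
    - lra.
    - specialize (Hpos x y a Hx).
      rewrite Ey, Rmult_0_r in Hpos.
      apply (Rlt_irrefl 0), Hpos; [apply Rabs_def1; lra | easy]. }
  destruct (zero_persists g c 0 0 0 d) as [rho0 Hrho0]; try easy.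
  { unfold d; lra. }
  { intros y Hy. rewrite Rminus_0_r in Hy. apply Hpos; try easy. unfold d in Hy; lra. }
  set (rho := Rmin rho0 r).
  assert (Hrho1 : rho <= rho0) by apply Rmin_l.
  assert (Hrho2 : rho <= r) by apply Rmin_r.
  (* The bounds on [q] stand under the existential, so that choice applies to the whole plane;
     outside the box the value is the default 0. *)
  assert (Hex : forall q : R * R, exists y, Rabs (fst q) < rho -> Rabs (snd q) < rho ->
            Rabs y < d /\ g (fst q) y (snd q) = 0).
  { intros [x a]; simpl.
    destruct (Rlt_dec (Rabs x) rho) as [Hx |]; [| now exists 0].
    destruct (Rlt_dec (Rabs a) rho) as [Ha |]; [| now exists 0].
    destruct (Hrho0 (x, a)) as [y Hy].
    - split; simpl; unfold ball; simpl; unfold AbsRing_ball, abs, minus, plus, opp; simpl;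
        rewrite Ropp_0, Rplus_0_r; lra.
    - exists y. rewrite Rminus_0_r in Hy. now simpl in Hy. }
  destruct (functional_choice _ Hex) as [Z HZ].
  exists (fun x a => Z (x, a)), rho, d.
  split; [split; [apply Rmin_glb_lt; [apply cond_pos | easy] | easy] |].
  split; [unfold d; lra |].
  assert (Hd : d < r) by (unfold d; lra).
  assert (Hiff : forall x a y, Rabs x < rho -> Rabs a < rho -> Rabs y < d ->
            (g x y a = 0 <-> y = Z (x, a))).
  { intros x a y Hx Ha Hy. destruct (HZ (x, a) Hx Ha) as [HZ1 HZ2]. simpl in HZ2.
    split; [| now intros ->].
    intros E. destruct (Rtotal_order y (Z (x, a))) as [H | [H | H]]; [| easy |]; exfalso.
    - apply (Huniq x a y (Z (x, a))); lra.
    - apply (Huniq x a (Z (x, a)) y); lra. }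
  intros x a Hx Ha.
  destruct (HZ (x, a) Hx Ha) as [HZ1 HZ2]. simpl in HZ2.
  (* Near [(x, a)] there is a zero within [e] of [Z (x, a)]. As [e <= d - |Z (x, a)|], it stays in
     [|y| < d], where uniqueness identifies it with the value of [Z]. *)
  assert (Hc : continuous Z (x, a)).
  { apply filterlim_locally. intros eps.
    assert (He : 0 < Rmin eps (d - Rabs (Z (x, a)))).
    { apply Rmin_glb_lt; [apply cond_pos | lra]. }
    pose proof (Rmin_l eps (d - Rabs (Z (x, a)))) as M1.
    pose proof (Rmin_r eps (d - Rabs (Z (x, a)))) as M2.
    set (e := Rmin eps (d - Rabs (Z (x, a)))) in *.
    assert (Htri : forall y, Rabs y <= Rabs (y - Z (x, a)) + Rabs (Z (x, a))).
    { intros y. replace y with ((y - Z (x, a)) + Z (x, a)) at 1 by ring. apply Rabs_triang. }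
    generalize (filter_and _ _ (locally_box2 x a rho Hx Ha)
                  (zero_persists g c x (Z (x, a)) a e Hg He HZ2
                     ltac:(intros y Hy; specialize (Htri y); apply Hpos; lra))).
    apply filter_imp. intros [x' a'] [[Hx' Ha'] [y [Hy Ey]]]; simpl in *.
    specialize (Htri y).
    apply Hiff in Ey; [| easy | easy | lra]. subst y.
    change (Rabs (Z (x', a') - Z (x, a)) < eps). lra. }
  assert (Hne : partial_y g x (Z (x, a)) a <> 0).
  { intros E. specialize (Hpos x (Z (x, a)) a). rewrite E, Rmult_0_r in Hpos.
    apply (Rlt_irrefl 0), Hpos; lra. }
  split; [easy |]. split; [intros y Hy; now apply Hiff |]. split.
  - apply (is_derive_implicit (fun t y => g t y a) (fun t => Z (t, a))).
    + now apply smooth_differentiable_xy.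
    + easy.
    + apply (continuous_comp (fun t => (t, a)) Z); [| easy].
      apply (continuous_comp_2 (fun t : R => t) (fun _ : R => a) (fun u v : R => (u, v))).
      * apply continuous_id.
      * apply continuous_const.
      * apply continuous_ext with (fun q : R * R => q); [now intros [] | apply continuous_id].
    + generalize (locally_Rabs_lt _ _ Hx). apply filter_imp. intros t Ht. now apply (HZ (t, a)).
  - apply (is_derive_implicit (fun t y => g x y t) (fun t => Z (x, t))).
    + now apply smooth_differentiable_ay.
    + easy.
    + apply (continuous_comp (fun t => (x, t)) Z); [| easy].
      apply (continuous_comp_2 (fun _ : R => x) (fun t : R => t) (fun u v : R => (u, v))).
      * apply continuous_const.
      * apply continuous_id.
      * apply continuous_ext with (fun q : R * R => q); [now intros [] | apply continuous_id].
    + generalize (locally_Rabs_lt _ _ Ha). apply filter_imp. intros t Ht. now apply (HZ (x, t)).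
Qed.

(** * Zeros of a one-parameter family of strictly convex functions *)

Lemma continuity_pt_pos_near0 (f : R -> R) :
  continuity_pt f 0 -> 0 < f 0 ->
  exists d, 0 < d /\ forall a, Rabs a < d -> 0 < f a.
Proof.
  intros Hc Hp. apply continuity_pt_filterlim in Hc.
  destruct (Hc _ (open_gt 0 (f 0) Hp)) as [d Hd].
  exists d. split; [apply cond_pos |].
  intros a Ha. apply (Hd a). unfold ball; simpl. unfold AbsRing_ball, abs, minus, plus, opp; simpl.
  now rewrite Ropp_0, Rplus_0_r.
Qed.

(** Here [p], [k], [m] are [h_x], [h_xx], [h_alpha], and [s] fixes the sign of [m]. The function
    [h(., 0)] is positive off its minimum 0 at the origin. If [s * a > 0], the graph is lifted off
    the axis. If [s * a < 0], it is pushed below the axis at [x = 0] but stays positive at the ends,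
    so it crosses twice, and convexity excludes more zeros. *)
Lemma convex_family_zeros (h p k m : R -> R -> R) (r s : R) :
  0 < r ->
  (forall x a, Rabs x < r -> Rabs a < r ->
     is_derive (fun t => h t a) x (p x a) /\ is_derive (fun t => p t a) x (k x a) /\
     is_derive (fun t => h x t) a (m x a) /\ 0 < k x a /\ 0 < s * m x a) ->
  h 0 0 = 0 -> p 0 0 = 0 ->
  exists e a0, 0 < e < r /\ 0 < a0 <= r /\
    forall a, 0 < Rabs a < a0 ->
      (exists u v, u < v /\ p u a <> 0 /\ p v a <> 0 /\
         forall x, (Rabs x < e /\ h x a = 0) <-> (x = u \/ x = v)) \/
      (forall x, Rabs x < e -> h x a <> 0).
Proof.
  intros Hr H h0 p0.
  assert (Hrr : forall x, - r < x < r -> Rabs x < r) by (intros x Hx; now apply Rabs_def1).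
  assert (R0 : Rabs 0 < r) by (apply Hrr; lra).
  assert (Hp : forall a u v, Rabs a < r -> - r < u -> u < v -> v < r -> p u a < p v a).
  { intros a u v Ha Hu Huv Hv.
    apply (is_derive_pos_incr (fun t => p t a) (fun t => k t a)); [easy | |];
    intros x Hx; apply H; try easy; apply Hrr; lra. }
  assert (Hh : forall x, - r < x < r -> x <> 0 -> 0 < h x 0).
  { intros x Hx Hx0. cut (h 0 0 < h x 0); [lra |].
    destruct (Rlt_le_dec x 0) as [Hn | Hn].
    - apply (is_derive_neg_decr (fun t => h t 0) (fun t => p t 0)); [easy | |]; intros y Hy.
      + apply H; try easy; apply Hrr; lra.
      + cut (p y 0 < p 0 0); [lra | apply Hp; lra].
    - apply (is_derive_pos_incr (fun t => h t 0) (fun t => p t 0)); [lra | |]; intros y Hy.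
      + apply H; try easy; apply Hrr; lra.
      + cut (p 0 0 < p y 0); [lra | apply Hp; lra]. }
  assert (Hend : forall x, - r < x < r -> x <> 0 ->
            exists d, 0 < d /\ forall a, Rabs a < d -> 0 < h x a).
  { intros x Hx Hx0. apply continuity_pt_pos_near0; [| now apply Hh].
    eapply is_derive_continuity_pt. apply (H x 0); [now apply Hrr | easy]. }
  (* The ends [r / 2] and [- (r / 2)] lie inside the domain, where [h(., 0) > 0]; the parameter is
     restricted so that [h] stays positive at both. *)
  destruct (Hend (r / 2)) as [d1 [Hd1 E1]]; [lra | lra |].
  destruct (Hend (- (r / 2))) as [d2 [Hd2 E2]]; [lra | lra |].
  exists (r / 2), (Rmin r (Rmin d1 d2)).
  split; [lra |]. split.
  { split; [repeat apply Rmin_glb_lt; easy | apply Rmin_l]. }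
  intros a [Ha0 Ha].
  assert (Har : Rabs a < r) by (eapply Rlt_le_trans; [apply Ha | apply Rmin_l]).
  assert (Had1 : Rabs a < d1).
  { eapply Rlt_le_trans; [apply Ha |]. eapply Rle_trans; [apply Rmin_r | apply Rmin_l]. }
  assert (Had2 : Rabs a < d2).
  { eapply Rlt_le_trans; [apply Ha |]. eapply Rle_trans; [apply Rmin_r | apply Rmin_r]. }
  specialize (E1 a Had1). specialize (E2 a Had2).
  (* Mean value theorem in the parameter, on an interval centred at 0 so that both signs of [a] are
     treated at once. *)
  assert (Hm : forall x, - r < x < r -> exists c, h x a = h x 0 + m x c * a /\ 0 < s * m x c).
  { intros x Hx.
    assert (Hc : forall c, Rabs (c - 0) <= Rabs a -> is_derive (fun t => h x t) c (m x c)).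
    { intros c Hc. rewrite Rminus_0_r in Hc. apply H; [now apply Hrr | lra]. }
    destruct (MVT_cor4 _ _ 0 (Rabs a) Hc a) as [c [Ec Hca]]; [rewrite Rminus_0_r; lra |].
    rewrite !Rminus_0_r in *.
    exists c. split; [lra |]. apply H; [now apply Hrr | lra]. }
  assert (Hane : a <> 0) by (intros ->; rewrite Rabs_R0 in Ha0; lra).
  destruct (Hm 0) as [c0 [Ec0 Hc0]]; [lra |].
  assert (Hs : s <> 0) by (intros ->; lra).
  destruct (Rlt_le_dec (s * a) 0) as [Hneg | Hpos].
  - left.
    (* Only the signs of [s * m] and [s * a] are known, so the sign of [m * a] is read off after
       multiplication by [s * s]. *)
    assert (Hh0 : h 0 a < 0).
    { rewrite Ec0, h0. assert (0 < (s * m 0 c0) * - (s * a)) by (apply Rmult_lt_0_compat; lra).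
      assert (0 < s * s) by (apply Rsqr_pos_lt; easy).
      apply Rmult_lt_reg_l with (s * s); [easy | lra]. }
    assert (Hcont : forall x, - r < x < r -> continuity_pt (fun t => h t a) x).
    { intros x Hx. apply is_derive_continuity_pt with (p x a).
      apply (H x a); [now apply Hrr | easy]. }
    destruct (IVT_interv (fun t => h t a) 0 (r / 2)) as [v [Hv Ev]]; [| lra | easy | easy |].
    { intros x Hx. apply Hcont; lra. }
    (* On the left half [h] falls from positive to negative, whereas [IVT_interv] wants a rise;
       hence the opposite sign. *)
    destruct (IVT_interv (fun t => - h t a) (- (r / 2)) 0) as [u [Hu Eu]]; [| lra | lra | lra |].
    { intros x Hx. apply continuity_pt_opp, Hcont; lra. }
    assert (Hu' : - (r / 2) < u < 0).
    { split; destruct Hu as [[Hu1 | Hu1] [Hu2 | Hu2]]; subst; lra. }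
    assert (Hv' : 0 < v < r / 2).
    { split; destruct Hv as [[Hv1 | Hv1] [Hv2 | Hv2]]; subst; lra. }
    assert (HR : forall x y, - r < x -> x < y -> y < r -> h x a = 0 -> h y a = 0 ->
              exists c, x < c < y /\ p c a = 0).
    { intros x y Hx Hxy Hy Ex Ey.
      apply (is_derive_Rolle (fun t => h t a) (fun t => p t a)); [easy | | lra].
      intros t Ht. apply H; [apply Hrr; lra | easy]. }
    assert (HP : forall x y, - r < x -> x < y -> y < r -> p x a = 0 -> p y a = 0 -> False).
    { intros x y Hx Hxy Hy Ex Ey. specialize (Hp a x y Har Hx Hxy Hy). lra. }
    (* Three zeros of [h] would give two zeros of the strictly increasing [p]. *)
    assert (H3 : forall x y z, - r < x -> x < y -> y < z -> z < r ->
              h x a = 0 -> h y a = 0 -> h z a = 0 -> False).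
    { intros x y z Hx Hxy Hyz Hz Ex Ey Ez.
      destruct (HR x y) as [c [Hc Ec]]; try lra.
      destruct (HR y z) as [c' [Hc' Ec']]; try lra.
      apply (HP c c'); lra. }
    (* The single zero [c] of [p] lies strictly between [u] and [v], so [p] vanishes at neither. *)
    destruct (HR u v) as [c [Hc Ec]]; try lra.
    exists u, v. split; [lra |]. split; [| split].
    + intros Eq. apply (HP u c); lra.
    + intros Eq. apply (HP c v); lra.
    + intros x. split.
      * intros [Hx Ex]. apply Rabs_def2 in Hx.
        destruct (Rtotal_order x u) as [Hxu | [Hxu | Hxu]]; [| now left |].
        { exfalso. apply (H3 x u v); lra. }
        destruct (Rtotal_order x v) as [Hxv | [Hxv | Hxv]]; [| now right |]; exfalso.
        { apply (H3 u x v); lra. }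
        { apply (H3 u v x); lra. }
      * intros [-> | ->]; (split; [apply Rabs_def1; lra | lra]).
  - right. intros x Hx. apply Rabs_def2 in Hx.
    destruct (Hm x) as [c [Ecx Hcx]]; [lra |].
    assert (0 < s * a) by (destruct Hpos as [|E]; [easy |]; symmetry in E;
      apply Rmult_integral in E; tauto).
    assert (0 < (s * m x c) * (s * a)) by (apply Rmult_lt_0_compat; lra).
    assert (0 < s * s) by (apply Rsqr_pos_lt; easy).
    assert (0 < m x c * a) by (apply Rmult_lt_reg_l with (s * s); [easy | lra]).
    assert (0 <= h x 0).
    { destruct (Req_dec x 0) as [-> | Hx0]; [lra | apply Rlt_le, Hh; [lra | easy]]. }
    lra.
Qed.

(** * Continuity of arithmetic operations, and positivity near a point *)

Section ContinuousArith.
Context {T : UniformSpace} (f g : T -> R) (t : T).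
Hypotheses (Hf : continuous f t) (Hg : continuous g t).

Lemma continuous_Rplus : continuous (fun s => f s + g s) t.
Proof. exact (continuous_plus (V := R_NormedModule) f g t Hf Hg). Qed.

Lemma continuous_Rmult : continuous (fun s => f s * g s) t.
Proof. exact (continuous_mult (K := R_AbsRing) f g t Hf Hg). Qed.

Lemma continuous_Rdiv : g t <> 0 -> continuous (fun s => f s / g s) t.
Proof.
  intros H. apply (continuous_mult (K := R_AbsRing) f (fun s => / g s) t Hf).
  exact (filterlim_comp _ _ _ g Rinv _ _ _ Hg (continuous_Rinv (g t) H)).
Qed.
End ContinuousArith.

Lemma continuous_Ropp {T : UniformSpace} (f : T -> R) (t : T) :
  continuous f t -> continuous (fun s => - f s) t.
Proof. exact (continuous_opp (V := R_NormedModule) f t). Qed.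

Lemma locally_box3 (P : R * R * R -> Prop) :
  locally ((0, 0, 0) : R * R * R) P ->
  exists r, 0 < r /\ forall x y a, Rabs x < r -> Rabs y < r -> Rabs a < r -> P (x, y, a).
Proof.
  intros [r Hr]. exists r. split; [apply cond_pos |].
  intros x y a Hx Hy Ha. apply Hr.
  repeat split; unfold ball; simpl; unfold AbsRing_ball, abs, minus, plus, opp; simpl;
    now rewrite Ropp_0, Rplus_0_r.
Qed.

Lemma locally_pos {T : UniformSpace} (f : T -> R) (t : T) :
  continuous f t -> 0 < f t -> locally t (fun s => 0 < f s).
Proof. intros Hf H. exact (Hf _ (open_gt 0 _ H)). Qed.

(** * Total derivatives along the solution of [g = 0] *)

Section TotalDerivative.
Variable g : R -> R -> R -> R.

(* Along a solution [y = Y(x, a)] of [g = 0], the slopes are [Y_x] and [Y_a], and [total_x F],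
   [total_a F] are the derivatives of [F(x, Y(x, a), a)] in [x] and [a]. *)
Definition slope_x : R -> R -> R -> R :=
  fun x y a => - partial_x g x y a / partial_y g x y a.
Definition slope_a : R -> R -> R -> R :=
  fun x y a => - partial_a g x y a / partial_y g x y a.
Definition total_x (F : R -> R -> R -> R) : R -> R -> R -> R :=
  fun x y a => partial_x F x y a + partial_y F x y a * slope_x x y a.
Definition total_a (F : R -> R -> R -> R) : R -> R -> R -> R :=
  fun x y a => partial_a F x y a + partial_y F x y a * slope_a x y a.
(** The second derivative [Y_xx], by the quotient rule for [- g_x / g_y]. *)
Definition total_slope_x : R -> R -> R -> R :=
  fun x y a => (- total_x (partial_x g) x y a * partial_y g x y a
                + partial_x g x y a * total_x (partial_y g) x y a) / partial_y g x y a ^ 2.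
(** This is [h_xx], the derivative of [g_xx + g_xy * Y_x] along the solution. It is expanded by hand
    because the rule for [total_x F] asks for a globally smooth [F], while the slope is controlled
    only where [g_y <> 0]. *)
Definition total2_partial_x : R -> R -> R -> R :=
  fun x y a => total_x (partial_x (partial_x g)) x y a
    + (total_x (partial_y (partial_x g)) x y a * slope_x x y a
       + partial_y (partial_x g) x y a * total_slope_x x y a).

Hypothesis Hg : smooth g.

Lemma is_derive_total_x (F : R -> R -> R -> R) (Y : R -> R) (x a : R) :
  smooth F -> is_derive Y x (slope_x x (Y x) a) ->
  is_derive (fun t => F t (Y t) a) x (total_x F x (Y x) a).
Proof.
  intros HF HY. apply (is_derive_comp_2d (fun t y => F t y a) Y); [| easy].
  now apply smooth_differentiable_xy.
Qed.

Lemma is_derive_total_a (F : R -> R -> R -> R) (Y : R -> R) (x a : R) :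
  smooth F -> is_derive Y a (slope_a x (Y a) a) ->
  is_derive (fun t => F x (Y t) t) a (total_a F x (Y a) a).
Proof.
  intros HF HY. apply (is_derive_comp_2d (fun t y => F x y t) Y); [| easy].
  now apply smooth_differentiable_ay.
Qed.

Lemma is_derive_total_slope_x (Y : R -> R) (x a : R) :
  is_derive Y x (slope_x x (Y x) a) -> partial_y g x (Y x) a <> 0 ->
  is_derive (fun t => slope_x t (Y t) a) x (total_slope_x x (Y x) a).
Proof.
  intros HY Hne.
  pose proof (is_derive_total_x (partial_x g) Y x a (smooth_partial_x g Hg) HY) as H1.
  pose proof (is_derive_total_x (partial_y g) Y x a (smooth_partial_y g Hg) HY) as H2.
  apply is_derive_opp in H1.
  pose proof (is_derive_div _ _ _ _ _ H1 H2 Hne) as H.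
  replace (total_slope_x x (Y x) a) with
    ((opp (total_x (partial_x g) x (Y x) a) * partial_y g x (Y x) a
      - opp (partial_x g x (Y x) a) * total_x (partial_y g) x (Y x) a)
     / partial_y g x (Y x) a ^ 2); [exact H |].
  unfold total_slope_x, opp; simpl. field. easy.
Qed.

Lemma is_derive_total2 (Y : R -> R) (x a : R) :
  is_derive Y x (slope_x x (Y x) a) -> partial_y g x (Y x) a <> 0 ->
  is_derive (fun t => total_x (partial_x g) t (Y t) a) x (total2_partial_x x (Y x) a).
Proof.
  intros HY Hne.
  pose proof (smooth_partial_x g Hg) as Hgx.
  pose proof (is_derive_total_x _ Y x a (smooth_partial_x _ Hgx) HY) as H1.
  pose proof (is_derive_total_x _ Y x a (smooth_partial_y _ Hgx) HY) as H2.
  pose proof (is_derive_total_slope_x Y x a HY Hne) as H3.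
  pose proof (is_derive_mult _ _ _ _ _ H2 H3 Rmult_comm) as H4.
  exact (is_derive_plus _ _ _ _ _ H1 H4).
Qed.

Lemma continuous_slope_x (q : R * R * R) :
  uncurry3 (partial_y g) q <> 0 -> continuous (uncurry3 slope_x) q.
Proof.
  intros Hne. apply continuous_Rdiv; [apply continuous_Ropp | | easy].
  - now apply smooth_continuous, smooth_partial_x.
  - now apply smooth_continuous, smooth_partial_y.
Qed.

Lemma continuous_slope_a (q : R * R * R) :
  uncurry3 (partial_y g) q <> 0 -> continuous (uncurry3 slope_a) q.
Proof.
  intros Hne. apply continuous_Rdiv; [apply continuous_Ropp | | easy].
  - now apply smooth_continuous, smooth_partial_a.
  - now apply smooth_continuous, smooth_partial_y.
Qed.

Lemma continuous_total_x (F : R -> R -> R -> R) (q : R * R * R) :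
  smooth F -> uncurry3 (partial_y g) q <> 0 -> continuous (uncurry3 (total_x F)) q.
Proof.
  intros HF Hne. apply continuous_Rplus; [| apply continuous_Rmult].
  - now apply smooth_continuous, smooth_partial_x.
  - now apply smooth_continuous, smooth_partial_y.
  - now apply continuous_slope_x.
Qed.

Lemma continuous_total_a (F : R -> R -> R -> R) (q : R * R * R) :
  smooth F -> uncurry3 (partial_y g) q <> 0 -> continuous (uncurry3 (total_a F)) q.
Proof.
  intros HF Hne. apply continuous_Rplus; [| apply continuous_Rmult].
  - now apply smooth_continuous, smooth_partial_a.
  - now apply smooth_continuous, smooth_partial_y.
  - now apply continuous_slope_a.
Qed.

Lemma continuous_total2 (q : R * R * R) :
  uncurry3 (partial_y g) q <> 0 -> continuous (uncurry3 total2_partial_x) q.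
Proof.
  intros Hne.
  pose proof (smooth_partial_x g Hg) as Hgx.
  pose proof (smooth_partial_y g Hg) as Hgy.
  assert (Cgy : continuous (uncurry3 (partial_y g)) q) by now apply smooth_continuous.
  apply continuous_Rplus; [| apply continuous_Rplus; apply continuous_Rmult].
  - apply continuous_total_x; [now apply smooth_partial_x | easy].
  - apply continuous_total_x; [now apply smooth_partial_y | easy].
  - now apply continuous_slope_x.
  - now apply smooth_continuous, smooth_partial_y.
  - apply continuous_Rdiv; [apply continuous_Rplus; apply continuous_Rmult | |].
    + apply continuous_Ropp. now apply continuous_total_x.
    + easy.
    + now apply smooth_continuous.
    + now apply continuous_total_x.
    + apply continuous_Rmult; [easy |]. apply continuous_Rmult; [easy | apply continuous_const].
    + now apply pow_nonzero.
Qed.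
End TotalDerivative.

(** * Splitting or disappearance of the cubic fold *)

Theorem lemma4p3 (S : quasilinear_DAE)
  (hS : smooth_DAE S)
  (hM : cubic_fold_point S 0 (0, 0))
  (hf1 : dae_f1 S 0 0 0 <> 0)
  (hgy : partial_y (dae_g S) 0 0 0 <> 0)
  (hgxxx : partial_x (partial_x (partial_x (dae_g S))) 0 0 0 <> 0)
  (hdet : jacobian_ya (dae_g S) (partial_x (dae_g S)) 0 0 0 <> 0) :
  exists (U : R * R -> Prop) (a0 : R),
    locally ((0, 0) : R * R) U /\ 0 < a0 /\
    forall a : R, 0 < Rabs a < a0 ->
      exactly_two_folds_both_simple S a U \/ no_folds S a U.
Proof.
  destruct hS as [Hg [Hf1 _]]. destruct hM as [[Hg0 Hgx0] Hgxx0].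
  unfold jacobian_ya in hdet.
  unfold exactly_two_folds_both_simple, no_folds, simple_fold, fold_point.
  set (g := dae_g S) in *. set (f1 := dae_f1 S) in *. clearbody g f1. clear S.
  pose proof (smooth_partial_x g Hg) as Hgx.
  pose proof (smooth_partial_y g Hg) as Hgy.
  (* These values at the origin act as sign multipliers: a product such as [cy * partial_y g] is a
     positive square at the origin, hence positive nearby. The number [s] is the [alpha]-derivative
     there of the normalised family [c * h]. *)
  set (c := partial_x (partial_x (partial_x g)) 0 0 0) in *.
  set (cy := partial_y g 0 0 0) in *.
  set (cf := f1 0 0 0) in *.
  set (s := c * total_a g (partial_x g) 0 0 0).
  assert (Hsq : forall z, z <> 0 -> 0 < z * z) by (intros z Hz; now apply Rsqr_pos_lt).
  (* At the origin, [cy] times the total [alpha]-derivative of [g_x] is exactly the determinant of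
     [hdet]. *)
  assert (Hs : s <> 0).
  { unfold s, total_a, slope_a. fold cy.
    intros E. apply Rmult_integral in E. destruct E as [E | E]; [easy |].
    apply hdet.
    transitivity (cy * (partial_a (partial_x g) 0 0 0 +
      partial_y (partial_x g) 0 0 0 * (- partial_a g 0 0 0 / cy))); [field; easy |].
    rewrite E. ring. }
  (* As [g_x = g_xx = 0] at the origin, both [Y_x] and [Y_xx] vanish there and only [g_xxx]
     remains. *)
  assert (HK : total2_partial_x g 0 0 0 = c).
  { unfold total2_partial_x, total_slope_x, total_x, slope_x.
    rewrite Hgx0, Hgxx0. fold c cy. field. easy. }
  (* One box for four signs: [g_y] for solving in [y], [f1] for simplicity, [h_xx] for convexity,
     [h_alpha] for monotonicity in the parameter. *)
  destruct (locally_box3 (fun q => 0 < cy * uncurry3 (partial_y g) q /\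
      0 < cf * uncurry3 f1 q /\ 0 < c * uncurry3 (total2_partial_x g) q /\
      0 < s * (c * uncurry3 (total_a g (partial_x g)) q))) as [r [Hr Hbox]].
  { repeat apply filter_and; apply locally_pos;
      repeat (apply continuous_Rmult; [apply continuous_const |]).
    - now apply smooth_continuous.
    - now apply Hsq.
    - now apply smooth_continuous.
    - now apply Hsq.
    - now apply continuous_total2.
    - unfold uncurry3; simpl. rewrite HK. now apply Hsq.
    - now apply continuous_total_a.
    - now apply Hsq. }
  unfold uncurry3 in Hbox; simpl in Hbox.
  destruct (implicit_function g cy r Hg Hr Hg0) as (Y & rho & d & Hrho & Hd & HY).
  { intros x y a Hx Hy Ha. now apply Hbox. }
  assert (HY' : forall x a, Rabs x < rho -> Rabs a < rho ->
            0 < cy * partial_y g x (Y x a) a /\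
            0 < cf * f1 x (Y x a) a /\ 0 < c * total2_partial_x g x (Y x a) a /\
            0 < s * (c * total_a g (partial_x g) x (Y x a) a)).
  { intros x a Hx Ha. destruct (HY x a Hx Ha) as [HYd _]. apply Hbox; lra. }
  assert (Hnz : forall u v, 0 < u * v -> v <> 0) by (intros u v H ->; lra).
  assert (HY0 : Y 0 0 = 0).
  { symmetry. apply (HY 0 0); rewrite ?Rabs_R0; lra. }
  destruct (convex_family_zeros
    (fun x a => c * partial_x g x (Y x a) a)
    (fun x a => c * total_x g (partial_x g) x (Y x a) a)
    (fun x a => c * total2_partial_x g x (Y x a) a)
    (fun x a => c * total_a g (partial_x g) x (Y x a) a) rho s) as (e & a0 & He & Ha0 & Hz).
  - easy.
  - intros x a Hx Ha.
    destruct (HY x a Hx Ha) as (_ & _ & Yx & Ya).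
    destruct (HY' x a Hx Ha) as (Py & _ & Pk & Pm).
    split; [| split; [| split; [| easy]]].
    + apply is_derive_scal. now apply (is_derive_total_x g (partial_x g) (fun t => Y t a)).
    + apply is_derive_scal. apply (is_derive_total2 g Hg (fun t => Y t a)); [easy |].
      now apply Hnz with cy.
    + apply is_derive_scal. now apply (is_derive_total_a g (partial_x g) (fun t => Y x t)).
  - rewrite HY0, Hgx0. ring.
  - rewrite HY0. unfold total_x, slope_x. rewrite Hgx0, Hgxx0. fold cy. field. easy.
  (* The width [e] is the range in which the zeros of [h] are counted; the height [d] is that in
     which every zero of [g] lies on the graph of [Y]. *)
  - exists (fun q => Rabs (fst q) < e /\ Rabs (snd q) < d), a0.
    split; [| split; [easy |]].
    { apply filter_and.
      - apply (continuous_fst 0 0 _ (locally_Rabs_lt 0 e ltac:(rewrite Rabs_R0; lra))).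
      - apply (continuous_snd 0 0 _ (locally_Rabs_lt 0 d ltac:(rewrite Rabs_R0; lra))). }
    intros a Ha.
    assert (Har : Rabs a < rho) by lra.
    assert (Hfold : forall x y, (Rabs x < e /\ Rabs y < d) /\ g x y a = 0 /\ partial_x g x y a = 0
              <-> (Rabs x < e /\ c * partial_x g x (Y x a) a = 0) /\ y = Y x a).
    { intros x y. split.
      - intros [[Hx Hy] [E1 E2]].
        apply (HY x a) in E1; [| lra | easy | easy]. subst y. rewrite E2. repeat split; [easy | ring].
      - intros [[Hx E] ->]. apply Rmult_integral in E.
        destruct (HY x a) as (HYd & HYz & _); [lra | easy |].
        repeat split; [easy | easy | now apply HYz | tauto]. }
    destruct (Hz a Ha) as [(u & v & Huv & Pu & Pv & Huniq) | Hnone].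
    + left. exists (u, Y u a), (v, Y v a).
      assert (Hsimple : forall x, x = u \/ x = v -> c * total_x g (partial_x g) x (Y x a) a <> 0 ->
        (g x (Y x a) a = 0 /\ partial_x g x (Y x a) a = 0) /\ f1 x (Y x a) a <> 0 /\
        partial_y g x (Y x a) a <> 0 /\ partial_x (partial_x g) x (Y x a) a <> 0).
      { intros x Hx Px. apply Huniq in Hx.
        destruct (proj2 (Hfold x (Y x a)) (conj Hx eq_refl)) as [_ [E1 E2]].
        destruct (HY' x a) as (P1 & P2 & _); [lra | easy |].
        split; [easy |]. split; [now apply Hnz with cf |]. split; [now apply Hnz with cy |].
        (* With [g_x = 0] the slope term drops out, so [g_xx = 0] would make [h_x] vanish. *)
        intros E. apply Px. unfold total_x, slope_x. rewrite E, E2.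
        field. now apply Hnz with cy. }
      split; [| split; [| split]].
      * intros E. injection E. intros. lra.
      * intros [x y]. rewrite (Hfold x y), (Huniq x). split.
        -- intros [[-> | ->] ->]; tauto.
        -- intros [E | E]; injection E; intros -> ->; tauto.
      * apply Hsimple; tauto.
      * apply Hsimple; tauto.
    + right. intros [x y] HU HF.
      destruct (proj1 (Hfold x y) (conj HU HF)) as [[Hx E] _].
      now apply (Hnone x).
Qed.
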